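(* Let $p,q\in(1,+\infty)$ and let $p'$ be the conjugate exponent of $p$. Let $\alpha,\beta\ge 0$. Then $$\big|\|T_\alpha\|_{p,q}-\|T_\beta\|_{p,q}\big|\le \|T_\alpha-T_\beta\|_{p,q}\le |\alpha-\beta|^{1/p'}\,\Gamma\!\left(\tfrac{q}{p'}+1\right)^{1/q}.$$
   Context: For real $\alpha\ge 0$, $T_\alpha\colon L^p[0,1]\to L^q[0,1]$ is the bounded linear operator $(T_\alpha f)(x):=\int_0^{x^\alpha} f(y)\,dy$; for $\alpha=0$ this is $(T_0f)(x)=\int_0^1 f(y)\,dy$. $\|\cdot\|_{p,q}$ denotes the operator norm of operators $L^p[0,1]\to L^q[0,1]$. The conjugate exponent $p'$ satisfies $1/p+1/p'=1$. $\Gamma$ is the Euler Gamma function. *)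

(* Defs.v *)
From HB Require Import structures.
From mathcomp Require Import all_boot all_order all_algebra.
From mathcomp Require Import all_classical all_reals all_analysis.
From mathcomp Require Import measurable_realfun.

Set Implicit Arguments.
Unset Strict Implicit.
Unset Printing Implicit Defensive.

Import Order.TTheory GRing.Theory Num.Theory.
Import numFieldNormedType.Exports.

Local Open Scope classical_set_scope.
Local Open Scope ring_scope.

Section unit_interval.
Variable R : realType.

Let I01 : set (measurableTypeR R) := `[0%R, 1%R]%classic.

Lemma measurable_I01 : measurable I01.
Proof. exact: measurable_itv. Qed.

Lemma lebesgue_I01_fin : (@lebesgue_measure R I01 < +oo)%E.
Proof. by rewrite lebesgue_measure_itv/= lte01 oppr0 adde0 ltry. Qed.

(* Lebesgue measure of [0,1], as a finite measure on the whole line that does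
   not charge the complement of [0,1]; L^p[0,1] is the L^p space of this
   measure. *)
Definition leb01 : {finite_measure set (measurableTypeR R) -> \bar R} :=
  mfrestr measurable_I01 lebesgue_I01_fin.

End unit_interval.

Section gamma.
Variable R : realType.

Definition Gamma (s : R) : R :=
  \int[@lebesgue_measure R]_(t in `]0, +oo[) (t `^ (s - 1) * expR (- t)).

End gamma.

Section operators.
Variable R : realType.
Notation mu := (leb01 R).

Lemma exponent_ge1 (p : R) : 1 < p -> (1 <= p%:E)%E.
Proof. by move=> p1; rewrite lee_fin ltW. Qed.

Notation Lp01 p1 := (LfunType mu (exponent_ge1 p1)).

Definition Lnorm01 (p : R) (p1 : 1 < p) (f : Lp01 p1) : \bar R :=
  'N[mu]_(p%:E)[EFin \o f]%E.

(* Valued in the extended reals: +oo exactly when A is unbounded. *)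
Definition opnorm (p q : R) (p1 : 1 < p) (q1 : 1 < q)
    (A : {linear Lp01 p1 -> Lp01 q1}) : \bar R :=
  ereal_sup [set Lnorm01 (A f) | f in [set f | (Lnorm01 f <= 1)%E]].

(* The integral is against the measure of [0,1]; for x in [0,1] and alpha >= 0 this is
   the integral over [0, x^alpha], since then x^alpha is in [0,1]. Note that
   x `^ 0 = 1 for all x, including x = 0. *)
Definition Tfun (alpha : R) (f : R -> R) (x : R) : R :=
  \int[mu]_(y in `[0, x `^ alpha]) f y.

Lemma Lp01_integrable (p : R) (p1 : 1 < p) (f : Lp01 p1) :
  mu.-integrable setT (EFin \o f).
Proof.
apply/Lfun1_integrable; apply: (@Lfun_subset _ _ _ mu 1%E p%:E) => //.
- exact: exponent_ge1.
- exact: fin_num_measure.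
- exact: exponent_ge1.
- exact: LfunP.
Qed.

Lemma Lp01_integrable_itv (p : R) (p1 : 1 < p) (f : Lp01 p1) (c : R) :
  mu.-integrable (`[0%R, c]%classic : set R) (EFin \o f).
Proof.
by apply: (integrableS measurableT) => //; exact: Lp01_integrable.
Qed.

Lemma Tfun_measurable (alpha : R) (f : R -> R) :
  mu.-integrable setT (EFin \o f) -> measurable_fun setT (Tfun alpha f).
Proof.
move=> fi.
have main (g : R -> R) : mu.-integrable setT (EFin \o g) ->
    (forall y, 0 <= g y) ->
    measurable_fun setT (fun c : R => \int[mu]_(y in `[0, c]) g y).
  move=> gi g0; apply: nondecreasing_measurable => // s t st.
  have gS c : mu.-integrable (`[0%R, c]%classic : set R) (EFin \o g).
    by apply: (integrableS measurableT _ _ gi).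
  rewrite /Rintegral fine_le ?integrable_fin_num//.
  apply: ge0_subset_integral => //.
  - by case/integrableP: (gS t).
  - by move=> y _; rewrite lee_fin.
  - by move=> y /=; rewrite !in_itv/= => /andP[-> /le_trans]; apply.
have fS c : mu.-integrable (`[0%R, c]%classic : set R) (EFin \o f).
  by apply: (integrableS measurableT _ _ fi).
have fpi : mu.-integrable setT (EFin \o f^\+).
  by rewrite -funerpos; exact: integrable_funepos.
have fni : mu.-integrable setT (EFin \o f^\-).
  by rewrite -funerneg; exact: integrable_funeneg.
have -> : Tfun alpha f = (fun x : R =>
    (\int[mu]_(y in `[0, x]) f^\+ y - \int[mu]_(y in `[0, x]) f^\- y))
    \o (fun x : R => x `^ alpha).
  apply/funext => x /=; rewrite /Tfun -RintegralB//.
  - by apply: eq_Rintegral => y _; rewrite -{1}[f]funrposBneg.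
  - by apply: (integrableS measurableT _ _ fpi).
  - by apply: (integrableS measurableT _ _ fni).
apply: measurableT_comp; last exact: measurable_powR.
by apply: measurable_funB; apply: main => // y; rewrite ?funrpos_ge0 ?funrneg_ge0.
Qed.

Lemma Tfun_le (alpha : R) (f : R -> R) (x : R) :
  mu.-integrable setT (EFin \o f) ->
  `|Tfun alpha f x| <= \int[mu]_y `|f y|.
Proof.
move=> fi.
have fS : mu.-integrable (`[0%R, x `^ alpha]%classic : set R) (EFin \o f).
  by apply: (integrableS measurableT _ _ fi).
apply: (le_trans (le_normr_Rintegral _ fS)) => //.
rewrite /Rintegral fine_le ?integrable_fin_num//.
- exact: integrable_norm.
- exact: integrable_norm.
- apply: ge0_subset_integral => //.
  by case/integrableP: (integrable_norm fi).
Qed.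

Lemma Tfun_Lfun (alpha p q : R) (p1 : 1 < p) (q1 : 1 < q) (f : Lp01 p1) :
  Tfun alpha f \in Lfun mu q%:E.
Proof.
have fi := Lp01_integrable f.
have mT := Tfun_measurable alpha fi.
have q0 : 0 < q by exact: lt_trans q1.
rewrite inE; apply/andP; split; rewrite inE//=.
rewrite /finite_norm unlock poweR_lty//.
rewrite (_ : (\int[mu]_x _ = \int[mu]_x (`|Tfun alpha f x| `^ q)%:E)%E)//.
set M := \int[mu]_y `|f y|.
apply: (@le_lt_trans _ _ (\int[mu]_x (cst ((M `^ q)%:E) x))%E).
  apply: ge0_le_integral => //.
  - apply/measurable_EFinP.
    apply: (measurableT_comp (measurable_powR q)) => //.
    exact: measurableT_comp.
  - move=> x _; rewrite lee_fin ge0_ler_powR ?(ltW q0) ?nnegrE//.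
      exact: le_trans (Tfun_le alpha x fi).
    exact: Tfun_le.
by apply/integrable_lty => //; exact: finite_measure_integrable_cst.
Qed.

Definition Tmap (alpha p q : R) (p1 : 1 < p) (q1 : 1 < q) (f : Lp01 p1) :
  Lp01 q1 := Lfun_Sub (exponent_ge1 q1) (Tfun_Lfun alpha q1 f).

Lemma Tmap_linear (alpha p q : R) (p1 : 1 < p) (q1 : 1 < q) :
  linear (Tmap alpha q1 : Lp01 p1 -> Lp01 q1).
Proof.
move=> a f g; apply/LfuneqP => x.
change (Tfun alpha (fun y => a * f y + g y) x =
  a * Tfun alpha f x + Tfun alpha g x).
have fi := Lp01_integrable_itv f (x `^ alpha).
have gi := Lp01_integrable_itv g (x `^ alpha).
rewrite /Tfun RintegralD ?RintegralZl//.
exact: (integrableZl _ _ fi).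
Qed.

HB.instance Definition _ (alpha p q : R) (p1 : 1 < p) (q1 : 1 < q) :=
  GRing.isLinear.Build R (Lp01 p1) (Lp01 q1) _ (Tmap alpha q1)
    (@Tmap_linear alpha p q p1 q1).

End operators.

Arguments opnorm {R p q} p1 q1 A.
Arguments Tmap {R} alpha {p q} p1 q1 f.

(* Main.v *)
Require Import Defs.
From mathcomp Require Import all_boot all_order all_algebra.
From mathcomp Require Import all_classical all_reals all_analysis.
From mathcomp Require Import measurable_realfun lra.

Set Implicit Arguments.
Unset Strict Implicit.
Unset Printing Implicit Defensive.

Import Order.TTheory GRing.Theory Num.Theory.
Import numFieldNormedType.Exports.
Local Open Scope classical_set_scope.
Local Open Scope ring_scope.

(** Write T_a for [Tmap a]. The first inequality is the reverse triangle
    inequality for the operator norm ([le_dist_opnorm]). It needs both norms to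
    be finite, and they are at most 1: as [leb01] is a probability measure,
    Hoelder's inequality bounds |T_a f| pointwise by the L^p norm of f
    ([Tfun_le_Lnorm]).

    For the second one, T_a f (x) - T_b f (x) is up to sign the integral of f
    between x^a and x^b. Hoelder's inequality bounds it by |x^a - x^b|^(1/p')
    when the L^p norm of f is at most 1 ([dist_Tfun_le]). Since
    x = exp (ln x), the map a -> x^a is Lipschitz with constant - ln x, so
    |x^a - x^b| <= |a - b| (- ln x) on ]0, 1] ([dist_powR_le]). The q-th power
    of the L^q norm of the difference is therefore at most |a - b|^(q/p') times
    the integral over ]0, 1[ of (- ln x)^(q/p'). The substitution x = exp (- t)
    turns this integral into Gamma (q/p' + 1) ([integral_negln_powR]), and
    taking q-th roots gives the bound. *)

(** * Powers of the logarithm and the Gamma function *)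

Section gamma_log.
Context (R : realType).
Notation lambda := (@lebesgue_measure R).

Let inv_le_nat (n : nat) : (n.+1%:R^-1 : R) <= n.+1%:R.
Proof.
apply: (@le_trans _ _ 1); last by rewrite ler1n.
by rewrite invf_le1 ?ler1n ?ltr0n.
Qed.

Lemma bigcup_itv_inv_nat :
  \bigcup_n `[(n.+1%:R^-1 : R), n.+1%:R]%classic = `]0, +oo[%classic.
Proof.
apply/seteqP; split => [t [n _]/=|t /=]; rewrite !in_itv/=.
  move=> /andP[+ _]; rewrite andbT.
  by apply: lt_le_trans; rewrite invr_gt0 ltr0n.
rewrite andbT => t0.
pose n := Num.truncn (Num.max t t^-1).
exists n => //=; rewrite in_itv/=.
have M : Num.max t t^-1 < n.+1%:R by rewrite truncnS_gt.
apply/andP; split.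
  rewrite -[leRHS]invrK lef_pV2 ?posrE ?invr_gt0 ?ltr0n//.
  by apply: le_trans (ltW M); rewrite le_max lexx orbT.
by apply: le_trans (ltW M); rewrite le_max lexx.
Qed.

Lemma bigcup_itv_expN_nat :
  \bigcup_n `[expR (- n.+1%:R), expR (- n.+1%:R^-1)]%classic
  = `]0, 1[%classic :> set R.
Proof.
apply/seteqP; split => [x [n _]/=|x /=]; rewrite !in_itv/=.
  move=> /andP[nx xn]; rewrite (lt_le_trans (expR_gt0 _) nx)/=.
  by rewrite (le_lt_trans xn)// expR_lt1 oppr_lt0 invr_gt0 ltr0n.
move=> /andP[x0 x1].
have : (`]0, +oo[%classic : set R) (- ln x).
  by rewrite /= in_itv/= andbT oppr_gt0 ln_lt0// x0.
rewrite -bigcup_itv_inv_nat => -[n _]/=; rewrite in_itv/= => /andP[n1 n2].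
exists n => //=; rewrite in_itv/= -[x in _ <= x <= _]lnK ?posrE// !ler_expR.
by rewrite lerNl n2 lerNr n1.
Qed.

Let derive_expN :
  (fun t : R => expR (- t))^`()%classic = (fun t => - expR (- t)).
Proof.
apply/funext => t; rewrite derive1E.
by rewrite derive_val// mulrN1.
Qed.

Let continuous_expN : continuous (fun t : R => expR (- t)).
Proof.
move=> t; apply: (@continuous_comp _ _ _ -%R expR); last exact: continuous_expR.
exact: opp_continuous.
Qed.

(** The substitution x = exp (- t), reached as a limit of substitutions between
    the compact intervals [1/n, n] and [exp (- n), exp (- 1/n)]. These stay away
    from both ends, so G need not extend continuously to 0 or to 1. This matters
    for (- ln x) `^ s: it blows up at 0, and at x = 1 it involves y `^ s at
    y = 0, where that function jumps since y `^ s = 1 for y < 0. *)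
Lemma ge0_integral_expN (G : R -> R) :
  {in `]0, 1[%classic, continuous G} ->
  {in `]0, 1[, forall x, 0 <= G x} ->
  (\int[lambda]_(x in `]0%R, 1%R[) (G x)%:E =
   \int[lambda]_(t in `]0%R, +oo[) (G (expR (- t)) * expR (- t))%:E)%E.
Proof.
move=> cG G0.
have mG : measurable_fun (`]0%R, 1%R[%classic : set R) G.
  by apply: open_continuous_measurable_fun => //; exact: interval_open.
have expN01 (t : R) : 0 < t -> expR (- t) \in `]0, 1[.
  by move=> t0; rewrite in_itv/= expR_gt0 expR_lt1 oppr_lt0.
have mH : measurable_fun (`]0%R, +oo[%classic : set R)
    (fun t => G (expR (- t)) * expR (- t)).
  apply: open_continuous_measurable_fun; first exact: interval_open.
  move=> t; rewrite inE/= in_itv/= andbT => t0.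
  apply: cvgM; last exact: continuous_expN.
  apply: continuous_comp; first exact: continuous_expN.
  by apply: cG; rewrite inE; exact: expN01.
pose A n := `[expR (- n.+1%:R), expR (- n.+1%:R^-1)]%classic : set R.
pose B n := `[(n.+1%:R^-1 : R), n.+1%:R]%classic.
have AS n : A n `<=` `]0, 1[%classic.
  by rewrite -bigcup_itv_expN_nat; exact: bigcup_sup.
have BS n : B n `<=` `]0, +oo[%classic.
  by rewrite -bigcup_itv_inv_nat; exact: bigcup_sup.
have nat_le m n : (m <= n)%N -> (m.+1%:R <= n.+1%:R :> R) /\
    (n.+1%:R^-1 <= m.+1%:R^-1 :> R).
  move=> mn; have le_mn : (m.+1%:R <= n.+1%:R :> R) by rewrite ler_nat.
  by split => //; rewrite lef_pV2 ?posrE ?ltr0n.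
have cA : (\int[lambda]_(x in A n) (G x)%:E)%E @[n --> \oo]
    --> (\int[lambda]_(x in `]0%R, 1%R[) (G x)%:E)%E.
  rewrite -bigcup_itv_expN_nat; apply: ge0_nondecreasing_set_cvg_integral.
  - move=> m n /nat_le[mn nm]; apply/subsetPset; apply: subset_itv;
      by rewrite bnd_simp ler_expR lerN2.
  - by move=> n; exact: measurable_itv.
  - move=> n; apply/measurable_EFinP; exact: measurable_funS (AS n) mG.
  - by move=> n x /AS x01; rewrite lee_fin G0.
have cB : (\int[lambda]_(t in B n) (G (expR (- t)) * expR (- t))%:E)%E
    @[n --> \oo] -->
    (\int[lambda]_(t in `]0%R, +oo[) (G (expR (- t)) * expR (- t))%:E)%E.
  rewrite -bigcup_itv_inv_nat; apply: ge0_nondecreasing_set_cvg_integral.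
  - by move=> m n /nat_le[mn nm]; apply/subsetPset; apply: subset_itv;
      rewrite bnd_simp.
  - by move=> n; exact: measurable_itv.
  - move=> n; apply/measurable_EFinP; exact: measurable_funS (BS n) mH.
  - move=> n t /BS/=; rewrite in_itv/= andbT => t0.
    by rewrite lee_fin mulr_ge0 ?expR_ge0// G0// expN01.
suff AB n : (\int[lambda]_(x in A n) (G x)%:E =
    \int[lambda]_(t in B n) (G (expR (- t)) * expR (- t))%:E)%E.
  apply: (@cvg_unique _ (@ereal_hausdorff R) _ _ _ _ cA).
  by rewrite (_ : (fun n => _) = (fun n =>
    \int[lambda]_(t in B n) (G (expR (- t)) * expR (- t))%:E)%E)//;
    apply/funext => n; exact: AB.
rewrite /A /B (@integration_by_substitution_decreasing _
  (fun t => expR (- t)) G n.+1%:R^-1 n.+1%:R (inv_le_nat n)).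
- by apply: eq_integral => t _; rewrite derive_expN/= fctE opprK.
- by move=> x y _ _ xy; rewrite ltr_expR ltrN2.
- by rewrite derive_expN => t _; apply: cvgN; exact: continuous_expN.
- rewrite derive_expN; apply: is_cvgN; apply/cvg_ex.
  exists (expR (- n.+1%:R^-1)); apply: cvg_at_right_filter.
  exact: continuous_expN.
- rewrite derive_expN; apply: is_cvgN; apply/cvg_ex.
  exists (expR (- n.+1%:R)); apply: cvg_at_left_filter.
  exact: continuous_expN.
- split; first by move=> t _; exact: ex_derive.
  + by apply: cvg_at_right_filter; exact: continuous_expN.
  + by apply: cvg_at_left_filter; exact: continuous_expN.
- apply: continuous_in_subspaceT => x xA; apply: cG; move: xA.
  by rewrite !inE; exact: AS.
Qed.

(** The inequality u <= exp u at u = t / (2 s), raised to the power s. The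
    rate 1/2 leaves half of the decay of exp (- t) for integrability. *)
Lemma powR_le_expR (s t : R) : 0 < s -> 0 <= t ->
  t `^ s <= (2 * s) `^ s * expR (t / 2).
Proof.
move=> s0 t0; have s20 : 0 < 2 * s by rewrite mulr_gt0.
rewrite (_ : t / 2 = (t / (2 * s)) * s); last first.
  by rewrite invfM mulrA -[RHS]mulrA mulVf ?gt_eqF// mulr1.
rewrite expRM -powRM ?expR_ge0 ?(ltW s20)//.
apply: ge0_ler_powR; rewrite ?nnegrE ?(ltW s0)//.
  by rewrite mulr_ge0 ?expR_ge0 ?ltW.
rewrite -ler_pdivrMl// mulrC.
by apply: le_trans (expR_ge1Dx _); rewrite lerDr.
Qed.

(** [Gamma] is a real-valued integral, which would be 0 if the integral were
    infinite. Domination by the density of the exponential distribution of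
    rate 1/2 shows that it is finite, so [Gamma] has its usual value. *)
Lemma GammaE (s : R) : 0 < s ->
  ((Gamma (s + 1))%:E =
   \int[lambda]_(t in `]0%R, +oo[) (t `^ s * expR (- t))%:E)%E.
Proof.
move=> s0; rewrite /Gamma /Rintegral addrK fineK//.
rewrite ge0_fin_numE; last first.
  by apply: integral_ge0 => t _; rewrite lee_fin mulr_ge0 ?powR_ge0 ?expR_ge0.
pose C := (2 * s) `^ s * 2.
have mpdf : measurable_fun setT (EFin \o exponential_pdf (2^-1 : R)).
  by apply/measurable_EFinP; exact: measurable_exponential_pdf.
have pdf0 (t : R) : (0 <= (exponential_pdf 2^-1 t)%:E)%E.
  by rewrite lee_fin exponential_pdf_ge0.
apply: (@le_lt_trans _ _
    (\int[lambda]_(t in `]0%R, +oo[) (C%:E * (exponential_pdf 2^-1 t)%:E))%E).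
  apply: ge0_le_integral => //.
  - by move=> t _; rewrite lee_fin mulr_ge0 ?powR_ge0 ?expR_ge0.
  - apply/measurable_EFinP; apply: measurable_funTS.
    apply: measurable_funM; first exact: measurable_powR.
    apply: (measurableT_comp (@measurable_expR R)).
    exact: oppr_measurable.
  - by apply: measurable_funTS; apply: measurable_funeM.
  - move=> t /=; rewrite in_itv/= andbT => t0.
    rewrite -EFinM lee_fin (exponential_pdfE _ (ltW t0)).
    rewrite /C -!mulrA mulVKf//.
    have -> : - 2^-1 * t = t / 2 + - t by lra.
    by rewrite expRD mulrA ler_wpM2r ?expR_ge0// powR_le_expR// ltW.
rewrite ge0_integralZl_EFin//; last 2 first.
  exact: measurable_funTS.
  by rewrite mulr_ge0 ?powR_ge0.
rewrite lte_mul_pinfty ?lee_fin ?mulr_ge0 ?powR_ge0//.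
apply: (@le_lt_trans _ _ (\int[lambda]_t (exponential_pdf 2^-1 t)%:E)%E).
  exact: ge0_subset_integral.
by rewrite integral_exponential_pdf ?ltry.
Qed.

Lemma continuous_negln_powR (s : R) :
  {in `]0, 1[%classic, continuous (fun x : R => (- ln x) `^ s)}.
Proof.
move=> x; rewrite inE/= in_itv/= => /andP[x0 x1].
apply: (@continuous_comp _ _ _ (fun x => - ln x) (fun y => y `^ s)).
  by apply: cvgN; exact: continuous_ln.
apply: differentiable_continuous; apply/derivable1_diffP; apply: derivable_powR.
by rewrite in_itv/= andbT oppr_gt0 ln_lt0// x0.
Qed.

Lemma integral_negln_powR (s : R) : 0 < s ->
  (\int[lambda]_(x in `]0%R, 1%R[) ((- ln x) `^ s)%:E = (Gamma (s + 1))%:E)%E.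
Proof.
move=> s0; rewrite GammaE// ge0_integral_expN.
- by apply: eq_integral => t _; rewrite expRK opprK.
- exact: continuous_negln_powR.
- by move=> x _; exact: powR_ge0.
Qed.

(** With x = exp (- t), this says that t |-> exp (- a t) is Lipschitz in a
    with constant t. For a <= b, factor out x `^ a <= 1 and use
    1 - exp (- v) <= v. *)
Lemma dist_powR_le (x a b : R) : 0 < x <= 1 -> 0 <= a -> 0 <= b ->
  `|x `^ a - x `^ b| <= `|a - b| * - ln x.
Proof.
move=> /andP[x0 x1].
wlog ab : a b / a <= b.
  move=> H a0 b0; have [ab|/ltW ba] := leP a b; first exact: H.
  by rewrite distrC (distrC a); exact: H.
move=> a0 b0.
rewrite ger0_norm ?subr_ge0; last by apply: ger_powR => //; rewrite x0.
rewrite (ler0_norm (_ : a - b <= 0)) ?subr_le0//.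
have -> : x `^ b = x `^ a * x `^ (b - a).
  by rewrite -powRD ?(gt_eqF x0) ?implybT// addrC subrK.
rewrite -{1}[x `^ a]mulr1 -mulrBr.
have xa1 : x `^ a <= 1 by rewrite -[leRHS](powRr0 x) ger_powR ?x0.
have : 0 <= 1 - x `^ (b - a).
  by rewrite subr_ge0 -[leRHS](powRr0 x) ger_powR ?x0 ?subr_ge0.
move=> /(ler_wpM2r)/(_ _ _ xa1)/le_trans; apply; rewrite mul1r.
(* x `^ (b - a) is the exponential of (b - a) ln x *)
have := expR_ge1Dx ((b - a) * ln x).
rewrite mulrC expRM lnK ?posrE//.
lra.
Qed.

End gamma_log.

(** * Lebesgue norms on the unit interval *)

(** Hoelder's inequality for f and the indicator of D, whose norm is a power
    of the measure of D. *)
Lemma Rintegral_le_Lnorm d (T : measurableType d) (R : realType)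
    (nu : {measure set T -> \bar R}) (p p' : R) (D : set T) (f : T -> R) :
  0 < p -> 0 < p' -> p^-1 + p'^-1 = 1 -> measurable D ->
  measurable_fun setT f -> nu.-integrable D (EFin \o f) ->
  (`|\int[nu]_(y in D) f y|%:E <= nu D `^ p'^-1 * 'N[nu]_(p%:E)[EFin \o f])%E.
Proof.
move=> p0 p'0 pp' mD mf fD.
have mI : measurable_fun setT (\1_D : T -> R) by exact: measurable_indic.
have -> : (nu D `^ p'^-1 = 'N[nu]_(p'%:E)[EFin \o (\1_D : T -> R)])%E.
  rewrite unlock/=; congr (_ `^ _)%E.
  rewrite -[in LHS](setIT D) -(integral_indic nu measurableT mD).
  apply: eq_integral => x _; rewrite indicE; case: (x \in D) => /=.
    by rewrite normr1 powR1.
  by rewrite normr0 powR0 ?gt_eqF.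
apply: le_trans (hoelder nu mI mf p'0 p0 _); last by rewrite addrC.
rewrite Lnorm1 -abse_EFin fineK ?integrable_fin_num//.
have := le_abse_integral nu mD (measurable_int nu fD).
move=> /le_trans; apply.
rewrite integral_mkcond; apply: ge0_le_integral => //.
- by move=> x _; exact: erestrict_ge0.
- apply/(measurable_restrictT _ mD); apply: measurableT_comp => //.
  exact: measurable_int fD.
- apply/measurable_EFinP; apply: measurableT_comp => //.
  exact: measurable_funM.
- move=> x _; rewrite epatch_indic /= -EFinM lee_fin normrM mulrC.
  by rewrite ger0_norm// indicE; case: (_ \in _).
Qed.

Section Lnorm_leb01.
Context (R : realType).
Notation lambda := (@lebesgue_measure R).
Notation mu := (leb01 R).

Lemma leb01E (A : set (measurableTypeR R)) :
  measurable A -> A `<=` `[0, 1] -> mu A = lambda A.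
Proof. by move=> mA A01; rewrite /= /mfrestr /mrestr setIidl. Qed.

Lemma leb01_setT : mu setT = 1%E.
Proof.
by rewrite /= /mfrestr /mrestr setTI lebesgue_measure_itv/= lte01 oppr0 adde0.
Qed.

(** The measure [leb01] ignores the complement of ]0, 1[, and coincides with
    Lebesgue measure on the subsets of ]0, 1[. Dropping the endpoints removes
    the points where ln is 0 or meaningless. *)
Lemma ge0_integral_leb01 (f : measurableTypeR R -> \bar R) :
  measurable_fun setT f -> (forall x, 0 <= f x)%E ->
  (\int[mu]_x f x = \int[lambda]_(x in `]0%R, 1%R[) f x)%E.
Proof.
move=> mf f0.
have mC : measurable (~` (`]0, 1[%classic : set (measurableTypeR R))).
  by apply: measurableC; exact: measurable_itv.
rewrite (ge0_negligible_integral mC measurableT mf) //; last first.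
  rewrite /= /mfrestr /mrestr.
  rewrite (_ : _ `&` _ = [set 0; 1]); last first.
    apply/seteqP; split => x /=; rewrite !in_itv/=.
      move=> [/negP + /andP[x0 x1]]; rewrite negb_and -!leNgt => /orP[H|H].
        by left; apply/eqP; rewrite eq_le x0 H.
      by right; apply/eqP; rewrite eq_le x1 H.
    by move=> [->|->]; rewrite lexx ler01 ?ltxx ?andbF.
  by apply: countable_lebesgue_measure0; apply: finite_set_countable;
     exact: finite_set2.
rewrite setTD setCK; apply: eq_measure_integral => A mA A01.
apply: leb01E => // x /A01/=.
by rewrite !in_itv/= => /andP[/ltW-> /ltW->].
Qed.

(** Moves an estimate of an L^q norm to a Lebesgue integral over ]0, 1[, where
    - ln x is positive and the substitution x = exp (- t) is available. *)
Lemma le_Lnorm_leb01 (q : R) (h k : measurableTypeR R -> R) : 0 < q ->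
  measurable_fun setT h ->
  measurable_fun (`]0, 1[%classic : set (measurableTypeR R)) k ->
  (forall x, 0 < x < 1 -> `|h x| <= k x) ->
  ('N[mu]_(q%:E)[EFin \o h] <=
   (\int[lambda]_(x in `]0%R, 1%R[) ((k x) `^ q)%:E) `^ q^-1)%E.
Proof.
move=> q0 mh mk hk.
have mhq : measurable_fun setT (fun x => (`|h x| `^ q)%:E).
  apply/measurable_EFinP; apply: (measurableT_comp (measurable_powR q)) => //.
  exact: measurableT_comp.
rewrite unlock/=.
rewrite (_ : (\int[mu]_x _ = \int[mu]_x (`|h x| `^ q)%:E)%E)//.
have int0 d (T : measurableType d) (nu : {measure set T -> \bar R}) D
    (g : T -> R) : (\int[nu]_(x in D) (g x `^ q)%:E)%E \in `[0%E, +oo%E].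
  rewrite in_itv/= leey andbT.
  by apply: integral_ge0 => x _; rewrite lee_fin powR_ge0.
apply: gt0_ler_poweR; [by rewrite invr_ge0 ltW|exact: int0|exact: int0|].
rewrite ge0_integral_leb01//.
apply: ge0_le_integral => //.
- exact: measurable_funTS.
- by apply/measurable_EFinP; exact: (measurableT_comp (measurable_powR q)).
- move=> x /=; rewrite in_itv/= => x01; rewrite lee_fin.
  apply: ge0_ler_powR; rewrite ?nnegrE ?(ltW q0) ?hk//.
  by rewrite (le_trans _ (hk _ x01)).
Qed.

End Lnorm_leb01.

(** * The operator norm and its reverse triangle inequality *)

Section operators.
Context (R : realType).
Notation lambda := (@lebesgue_measure R).
Notation mu := (leb01 R).
Notation Lp01 p1 := (LfunType mu (exponent_ge1 p1)).

Lemma measurable_Lp01 (p : R) (p1 : 1 < p) (f : Lp01 p1) :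
  measurable_fun setT f.
Proof. by apply/measurable_EFinP; case/integrableP: (Lp01_integrable f). Qed.

Section opnorm_theory.
Variables (p q : R) (p1 : 1 < p) (q1 : 1 < q).
Implicit Types A B C : {linear Lp01 p1 -> Lp01 q1}.

Lemma opnorm_le A (M : \bar R) :
  (forall f, Lnorm01 f <= 1 -> Lnorm01 (A f) <= M)%E -> (opnorm p1 q1 A <= M)%E.
Proof. by move=> AM; apply: ge_ereal_sup => _ [f f1 <-]; exact: AM. Qed.

Lemma opnorm_ge0 A : (0 <= opnorm p1 q1 A)%E.
Proof.
apply: le_ereal_sup_tmp; exists (Lnorm01 (A 0)); last exact: Lnorm_ge0.
exists 0 => //=; rewrite /Lnorm01 (_ : _ \o _ = cst 0%E)//.
by rewrite Lnorm0 ?lee01// eqe gt_eqF// (lt_trans ltr01).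
Qed.

(** The hypothesis is on norms rather than on values so that it covers both
    A = B + C and A = B - C. *)
Lemma opnorm_le_add A B C :
  (forall f, Lnorm01 (A f) <= Lnorm01 (B f) + Lnorm01 (C f))%E ->
  (opnorm p1 q1 A <= opnorm p1 q1 B + opnorm p1 q1 C)%E.
Proof.
move=> ABC; apply: opnorm_le => f f1; apply: (le_trans (ABC f)).
by apply: leeD; apply: ereal_sup_ubound; exists f.
Qed.

(** The reverse triangle inequality. Finiteness matters: if both norms were
    infinite, their difference would be -oo, of infinite absolute value,
    although A - B could be 0. *)
Lemma le_dist_opnorm A B :
  opnorm p1 q1 A \is a fin_num -> opnorm p1 q1 B \is a fin_num ->
  (`|opnorm p1 q1 A - opnorm p1 q1 B| <= opnorm p1 q1 (A \- B)%R)%E.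
Proof.
move=> finA finB.
have AB : (opnorm p1 q1 A <= opnorm p1 q1 (A \- B)%R + opnorm p1 q1 B)%E.
  apply: opnorm_le_add => f.
  have := minkowski_EFin mu (measurable_Lp01 (A f - B f))
    (measurable_Lp01 (B f)) (ltW q1).
  apply: le_trans; rewrite le_eqVlt; apply/orP; left.
  by apply/eqP/eq_Lnorm => x /=; rewrite subrK.
have BA : (opnorm p1 q1 B <= opnorm p1 q1 (A \- B)%R + opnorm p1 q1 A)%E.
  rewrite addeC; apply: opnorm_le_add => f.
  have := lerB_DLnorm mu (measurable_Lp01 (B f))
    (measurable_Lp01 (A f - B f)) (ltW q1).
  move=> /le_trans; apply; apply: leeD => //; rewrite le_eqVlt; apply/orP; left.
  by apply/eqP/eq_Lnorm => x /=; rewrite addrC subrK.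
move: AB BA (opnorm_ge0 (A \- B)).
case: (opnorm p1 q1 (A \- B)%R) => [r| |] //; last by move=> *; rewrite leey.
rewrite -(fineK finA) -(fineK finB) -!EFinD !lee_fin => AB BA _.
by rewrite ler_norml; apply/andP; split; lra.
Qed.
End opnorm_theory.

(** * Estimates for the operators T_a *)

Lemma conj_exponent_gt0 (p p' : R) : 1 < p -> p^-1 + p'^-1 = 1 -> 0 < p'.
Proof.
move=> p1 pp'; rewrite -invr_gt0.
have : p^-1 < 1 by rewrite invf_lt1// (lt_trans ltr01).
lra.
Qed.

Lemma Tfun_le_Lnorm (p p' a : R) (p1 : 1 < p) (f : Lp01 p1) (x : R) :
  p^-1 + p'^-1 = 1 -> (`|Tfun a f x|%:E <= Lnorm01 f)%E.
Proof.
move=> pp'; have p'0 := conj_exponent_gt0 p1 pp'.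
apply: (le_trans (Rintegral_le_Lnorm (lt_trans ltr01 p1) p'0 pp' _ _
  (Lp01_integrable_itv f (x `^ a)))) => //.
rewrite -[leRHS]mul1e; apply: lee_wpmul2r; first exact: Lnorm_ge0.
rewrite -(poweR1r p'^-1); apply: gt0_ler_poweR.
- by rewrite invr_ge0 ltW.
- by rewrite in_itv/= leey andbT measure_ge0.
- by rewrite in_itv/= leey andbT.
- by rewrite -(leb01_setT R) le_measure ?inE.
Qed.

(** The difference is, up to sign, the integral of f over the interval between
    x `^ a and x `^ b, so Hoelder's inequality applies to that interval. *)
Lemma dist_Tfun_le (p p' a b : R) (p1 : 1 < p) (f : Lp01 p1) (x : R) :
  p^-1 + p'^-1 = 1 ->
  (`|Tfun a f x - Tfun b f x|%:E <=
   (`|x `^ a - x `^ b| `^ p'^-1)%:E * Lnorm01 f)%E.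
Proof.
move=> pp'; have p'0 := conj_exponent_gt0 p1 pp'.
rewrite /Tfun; move: (x `^ a) (x `^ b) (powR_ge0 x a) (powR_ge0 x b).
move=> {a b x} a b a0 b0.
wlog ab : a b a0 b0 / a <= b.
  move=> H; have [ab|/ltW ba] := leP a b; first exact: H.
  by rewrite distrC (distrC a); exact: H.
have ab_disj : [disjoint `[0%R, a]%classic & `]a, b]%classic].
  apply: lt_disjoint => u v; rewrite !in_itv/= => /andP[_ ua] /andP[+ _].
  exact: le_lt_trans.
have U : `[0%R, b]%classic = `[0%R, a]%classic `|` `]a, b]%classic.
  by rewrite -itv_bndbnd_setU ?bnd_simp.
have fb := Lp01_integrable_itv f b.
rewrite distrC U Rintegral_setU//; last by rewrite -U.
rewrite addrC addKr.
have fab : mu.-integrable (`]a, b]%classic : set R) (EFin \o f).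
  by apply: (integrableS measurableT _ _ (Lp01_integrable f)).
apply: (le_trans (Rintegral_le_Lnorm (lt_trans ltr01 p1) p'0 pp' _ _
  fab)) => //.
apply: lee_wpmul2r; first exact: Lnorm_ge0.
rewrite -poweR_EFin; apply: gt0_ler_poweR.
- by rewrite invr_ge0 ltW.
- by rewrite in_itv/= leey andbT measure_ge0.
- by rewrite in_itv/= leey andbT lee_fin.
- rewrite distrC ger0_norm ?subr_ge0//.
  apply: (@le_trans _ _ (lambda (`]a, b]%classic : set R))).
    by rewrite /= /mfrestr /mrestr le_measure// ?inE//; exact: measurableI.
  rewrite lebesgue_measure_itv/=; case: ifPn => //= _.
  by rewrite lee_fin subr_ge0.
Qed.

Lemma Lnorm01_Tmap_le1 (p p' q a : R) (p1 : 1 < p) (q1 : 1 < q) (f : Lp01 p1) :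
  p^-1 + p'^-1 = 1 -> (Lnorm01 f <= 1 -> Lnorm01 (Tmap a p1 q1 f) <= 1)%E.
Proof.
move=> pp' f1; have q0 := lt_trans ltr01 q1.
have Tf1 (x : R) : `|Tfun a f x| <= cst 1 x.
  by rewrite -lee_fin; exact: le_trans (Tfun_le_Lnorm a f x pp') f1.
have mT : measurable_fun setT (Tfun a f).
  apply: Tfun_measurable; exact: Lp01_integrable.
apply: (le_trans (le_Lnorm_leb01 q0 mT _ (fun x _ => Tf1 x))) => //.
rewrite (eq_integral (cst 1%E)); last by move=> x _; rewrite /= powR1.
rewrite integral_cst//= lebesgue_measure_itv/= lte01 oppr0 adde0 mule1.
by rewrite poweR1r.
Qed.

Lemma opnorm_Tmap_fin_num (p p' q a : R) (p1 : 1 < p) (q1 : 1 < q) :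
  p^-1 + p'^-1 = 1 -> opnorm p1 q1 (Tmap a p1 q1) \is a fin_num.
Proof.
move=> pp'; rewrite ge0_fin_numE ?opnorm_ge0//.
apply: (@le_lt_trans _ _ 1%E); last exact: ltry.
by apply: opnorm_le => f; exact: Lnorm01_Tmap_le1 pp'.
Qed.

(** Chaining [dist_Tfun_le] and [dist_powR_le] bounds the difference at x by
    (|a - b| (- ln x)) `^ (1 / p'), whose q-th power integrates to
    |a - b| `^ (q / p') * Gamma (q / p' + 1). *)
Lemma Lnorm01_Tmap_sub_le (p p' q a b : R) (p1 : 1 < p) (q1 : 1 < q)
    (f : Lp01 p1) : p^-1 + p'^-1 = 1 -> 0 <= a -> 0 <= b ->
  (Lnorm01 f <= 1 -> Lnorm01 (Tmap a p1 q1 f - Tmap b p1 q1 f)%R <=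
   (`|a - b| `^ p'^-1 * Gamma (q / p' + 1) `^ q^-1)%:E)%E.
Proof.
move=> pp' a0 b0 f1.
have q0 := lt_trans ltr01 q1.
have p'0 := conj_exponent_gt0 p1 pp'.
pose k (x : measurableTypeR R) := (`|a - b| * - ln x) `^ p'^-1.
have mk : measurable_fun (`]0, 1[%classic : set (measurableTypeR R)) k.
  apply: measurable_funTS.
  apply: (measurableT_comp (measurable_powR p'^-1)).
  apply: measurable_funM => //.
  by apply: measurableT_comp; [exact: oppr_measurable|exact: measurable_ln].
have Tk (x : R) : 0 < x < 1 -> `|Tfun a f x - Tfun b f x| <= k x.
  move=> /andP[x0 x1]; rewrite -lee_fin.
  apply: le_trans (dist_Tfun_le a b f x pp') _.
  rewrite -[leRHS]mule1.
  apply: lee_pmul; rewrite ?lee_fin ?powR_ge0 ?Lnorm_ge0//.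
  apply: ge0_ler_powR; rewrite ?nnegrE ?invr_ge0 ?(ltW p'0)//.
    by rewrite mulr_ge0// oppr_ge0 ln_le0// ltW.
  by apply: dist_powR_le; rewrite // x0 ltW.
have mT : measurable_fun setT (Tfun a f \- Tfun b f).
  by apply: measurable_funB; apply: Tfun_measurable; exact: Lp01_integrable.
apply: (le_trans (le_Lnorm_leb01 q0 mT mk Tk)).
have kE (x : measurableTypeR R) :
    x \in (`]0, 1[%classic : set (measurableTypeR R)) ->
    (k x `^ q)%:E = ((`|a - b| `^ (q / p'))%:E * ((- ln x) `^ (q / p'))%:E)%E.
  rewrite inE/= in_itv/= => /andP[x0 x1].
  by rewrite /k -powRrM (mulrC p'^-1) powRM ?EFinM// oppr_ge0 ln_le0// ltW.
rewrite (eq_integral _ _ kE) ge0_integralZl_EFin ?powR_ge0//.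
- rewrite integral_negln_powR ?divr_gt0//.
  rewrite -EFinM poweR_EFin lee_fin powRM ?powR_ge0//; last first.
    rewrite -lee_fin GammaE ?divr_gt0//.
    by apply: integral_ge0 => t _; rewrite lee_fin mulr_ge0 ?powR_ge0 ?expR_ge0.
  by rewrite -powRrM mulrAC mulfV ?gt_eqF// mul1r.
- by move=> x _; rewrite lee_fin powR_ge0.
- apply: measurable_funTS; apply/measurable_EFinP.
  apply: (measurableT_comp (measurable_powR _)).
  by apply: measurableT_comp; [exact: oppr_measurable|exact: measurable_ln].
Qed.

End operators.

Theorem theorem1 (R : realType) (p q p' : R) (p1 : 1 < p) (q1 : 1 < q)
    (pp' : 1 / p + 1 / p' = 1) (alpha beta : R)
    (alpha0 : 0 <= alpha) (beta0 : 0 <= beta) :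
  (`|opnorm p1 q1 (Tmap alpha p1 q1) - opnorm p1 q1 (Tmap beta p1 q1)|
     <= opnorm p1 q1 (Tmap alpha p1 q1 \- Tmap beta p1 q1)%R)%E /\
  (opnorm p1 q1 (Tmap alpha p1 q1 \- Tmap beta p1 q1)%R
     <= (`|alpha - beta| `^ (1 / p') * Gamma (q / p' + 1) `^ (1 / q))%:E)%E.
Proof.
rewrite !mul1r in pp' *.
split; first by apply: le_dist_opnorm; exact: opnorm_Tmap_fin_num pp'.
by apply: opnorm_le => f; exact: Lnorm01_Tmap_sub_le.
Qed.
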